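(* In each of the three settings (agents in $\mathbb{R}$; agents in $\mathbb{R}^2$ with the $L_1$ norm; agents in $\mathbb{R}^2$ with the $L_2$ norm), let $I$ be an instance with preferred distances bounded by $B$. Suppose there are $r$ agents whose locations are within distance $B$ of the median location $\mathrm{med}$, and suppose the average of the values $b_i$ over these $r$ agents is $\overline{b}$. Then the Median algorithm achieves social cost at most $OPT(I)+2r\overline{b}$, i.e. $SC(\mathrm{med},I)\le OPT(I)+2r\overline{b}$.
   Context: Let $\Omega=\mathbb{R}$ with the absolute value, or $\Omega=\mathbb{R}^2$ with the $L_1$ norm, or $\Omega=\mathbb{R}^2$ with the $L_2$ norm; write $\|\cdot\|$ for the norm (distance is measured in this norm). An instance with $n\ge1$ agents is a tuple $I=\langle (x_1,b_1),\dots,(x_n,b_n)\rangle$ with locations $x_i\in\Omega$ and preferred distances $b_i\in[0,B]$. The cost of agent $i$ when the facility is at $y\in\Omega$ is $cost(y,(x_i,b_i))=\big|\,\|x_i-y\|-b_i\,\big|$. The social cost is $SC(y,I)=\sum_i cost(y,(x_i,b_i))$ and $OPT(I)=\min_{y\in\Omega}SC(y,I)$. The Median algorithm places the facility at the location $\mathrm{med}$ defined as follows. In $\mathbb{R}$: $\mathrm{med}$ is the element of rank $\lfloor (n+1)/2\rfloor$ (in increasing order) among $x_1,\dots,x_n$. In $\mathbb{R}^2$ with $L_1$: each coordinate of $\mathrm{med}$ is the rank-$\lfloor (n+1)/2\rfloor$ element among the corresponding coordinates of the agents' locations. In $\mathbb{R}^2$ with $L_2$: $\mathrm{med}$ is a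 geometric median, i.e. a point minimizing $\sum_i\|x_i-y\|_2$ over $y\in\mathbb{R}^2$. (If $r=0$, $r\overline{b}$ is read as $0$.) *)

(* Defs.v *)
From HB Require Import structures.
From mathcomp Require Import all_boot all_order all_algebra.
From mathcomp Require Import all_classical all_reals all_analysis.

Set Implicit Arguments.
Unset Strict Implicit.
Unset Printing Implicit Defensive.

Import Order.TTheory GRing.Theory Num.Theory.
Import numFieldNormedType.Exports.
Local Open Scope classical_set_scope.
Local Open Scope ring_scope.

(** The library norm on ['rV[R]_2] is the sup norm, so the L1 and L2
    norms are defined here. *)
Definition l1norm (R : realType) (x : 'rV[R]_2) : R := \sum_j `|x 0 j|.

Definition l2norm (R : realType) (x : 'rV[R]_2) : R :=
  Num.sqrt (\sum_j x 0 j ^+ 2).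

Section Instance.
Context (R : realType) (V : zmodType) (nm : V -> R) (n : nat).
Implicit Types (I : n.-tuple (V * R)) (y : V) (B : R).

Definition loc I (i : 'I_n) : V := (tnth I i).1.

Definition pref I (i : 'I_n) : R := (tnth I i).2.

Definition prefs_bounded B I : Prop := forall i, 0 <= pref I i <= B.

Definition cost y (a : V * R) : R := `|nm (a.1 - y) - a.2|.

Definition SC y I : R := \sum_(i < n) cost y (tnth I i).

(** The infimum is a minimum in each of the three settings: see
    [OPT_attained_line], [OPT_attained_l1] and [OPT_attained_l2]. *)
Definition OPT I : R := inf [set SC y I | y in [set: V]].

Definition agents_within B y I : {set 'I_n} :=
  [set i : 'I_n | nm (loc I i - y) <= B]%SET.

(** Equal to [0] when [A] is empty, since [0 / 0 = 0]. *)
Definition avg_pref I (A : {set 'I_n}) : R :=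
  (\sum_(i in A) pref I i) / #|A|%:R.

Definition is_geometric_median I y : Prop :=
  forall z, \sum_(i < n) nm (loc I i - y) <= \sum_(i < n) nm (loc I i - z).

End Instance.

(** Ranks start at 1 whereas [nth] counts from 0; the default value [0] is only
    reached when [n = 0]. *)
Definition rank_median (R : realType) (n : nat) (x : 'I_n -> R) : R :=
  nth 0 (sort <=%R [seq x i | i <- enum 'I_n]) (n.+1 %/ 2).-1.

Definition coord_median (R : realType) (n : nat) (x : 'I_n -> 'rV[R]_2) :
  'rV[R]_2 := \row_j rank_median (fun i => x i 0 j).

Section Attainment.
Context (R : realType).

Lemma OPT_attained (V : normedModType R) (nm : V -> R) (n : nat)
    (I : n.-tuple (V * R)) :
  (forall M, compact [set y : V | `|y| <= M]) ->
  continuous nm -> (forall x, `|x| <= nm x) ->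
  exists2 y, SC nm y I = OPT nm I & forall z, SC nm y I <= SC nm z I.
Proof.
move=> cpt cnm le_nm.
suff [y ymin] : exists y, forall z, SC nm y I <= SC nm z I.
  exists y => //; apply/eqP; rewrite eq_le; apply/andP; split.
    apply: lb_le_inf; first by exists (SC nm y I), y.
    by move=> _ [z _ <-].
  apply: ge_inf; last by exists y.
  by exists (SC nm y I) => _ [z _ <-].
case: n I => [|n] I; first by exists 0 => z; rewrite /SC !big_ord0.
have cost_ge0 y a : 0 <= cost nm y a by exact: normr_ge0.
pose a := tnth I ord0.
pose M := SC nm 0 I + a.2 + `|a.1|.
have out z : M < `|z| -> SC nm 0 I <= SC nm z I.
  move=> Mz; have : cost nm z a <= SC nm z I.
    by rewrite /SC (bigD1 ord0) //= lerDl sumr_ge0.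
  apply: le_trans; apply: le_trans (ler_norm _).
  rewrite lerBrDr (le_trans _ (le_nm _)) // distrC.
  apply: le_trans (lerB_dist _ _).
  by rewrite lerBrDr ltW.
have cSC : continuous (fun y => SC nm y I).
  apply: continuous_big; first exact: add_continuous.
  move=> i _ y.
  rewrite /cost; apply: cvg_norm; apply: cvgB; last exact: cvg_cst.
  apply: (continuous_comp (f := fun y => (tnth I i).1 - y) (g := nm)).
    by apply: cvgB; first exact: cvg_cst; exact: cvg_id.
  exact: cnm.
have [M0|M0] := leP 0 M; last first.
  by exists 0 => z; apply: out; exact: lt_le_trans M0 _.
have [||c cM cmin] := @compact_EVT_min _ _ (fun y => SC nm y I)
    [set y : V | `|y| <= M] _ (cpt M).
- by exists 0; rewrite /= normr0.
- exact: continuous_subspaceT.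
exists c => z; have [zM|zM] := leP `|z| M; first by apply: cmin; rewrite inE.
apply: le_trans (out _ zM); apply: cmin.
by rewrite inE /= normr0.
Qed.

Lemma OPT_attained_line n (I : n.-tuple (R * R)) :
  exists2 y, SC Num.norm y I = OPT Num.norm I
           & forall z, SC Num.norm y I <= SC Num.norm z I.
Proof.
apply: (@OPT_attained R^o) => // [M|]; last exact: norm_continuous.
rewrite (_ : [set y | _] = `[- M, M]%classic); first exact: segment_compact.
by apply/seteqP; split => y /=; rewrite in_itv /= ler_norml.
Qed.

Lemma compact_ball_rV M : compact [set y : 'rV[R]_2 | `|y| <= M].
Proof.
apply: bounded_closed_compact.
  exists M; split; first exact: num_real.
  by move=> N /ltW MN y /= /le_trans; apply.
apply: (@preimage_closed _ _ (fun y : 'rV[R]_2 => `|y|) [set x | x <= M]).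
  by move=> y _; exact: norm_continuous.
exact: closed_le.
Qed.

Lemma rV_norm_le (x : 'rV[R]_2) M :
  0 <= M -> (forall j, `|x 0 j| <= M) -> `|x| <= M.
Proof.
move=> M0 xM; rewrite [leLHS]/Num.norm /= mx_normrE.
by apply/bigmax_leP; split => // -[i j] _; rewrite (ord1 i) xM.
Qed.

Lemma OPT_attained_l1 n (I : n.-tuple ('rV[R]_2 * R)) :
  exists2 y, SC (@l1norm R) y I = OPT (@l1norm R) I
           & forall z, SC (@l1norm R) y I <= SC (@l1norm R) z I.
Proof.
apply: OPT_attained => [|x|x]; first exact: compact_ball_rV.
  apply: continuous_big => [|j _ {}x]; first exact: add_continuous.
  apply: (continuous_comp (f := fun y : 'rV[R]_2 => y 0 j)).
    exact: coord_continuous.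
  exact: norm_continuous.
apply: rV_norm_le => [|j]; first exact: sumr_ge0.
by rewrite /l1norm (bigD1 j) //= lerDl sumr_ge0.
Qed.

Lemma OPT_attained_l2 n (I : n.-tuple ('rV[R]_2 * R)) :
  exists2 y, SC (@l2norm R) y I = OPT (@l2norm R) I
           & forall z, SC (@l2norm R) y I <= SC (@l2norm R) z I.
Proof.
apply: OPT_attained => [|x|x]; first exact: compact_ball_rV.
  apply: (continuous_comp (f := fun x : 'rV[R]_2 => \sum_j x 0 j ^+ 2)
    (g := Num.sqrt)); last exact: sqrt_continuous.
  apply: continuous_big => [|j _ {}x]; first exact: add_continuous.
  apply: (continuous_comp (f := fun y : 'rV[R]_2 => y 0 j)
    (g := fun t : R => t ^+ 2)); first exact: coord_continuous.
  exact: exprn_continuous.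
apply: rV_norm_le => [|j]; first exact: sqrtr_ge0.
rewrite /l2norm -sqrtr_sqr ler_wsqrtr //.
by rewrite (bigD1 j) //= lerDl sumr_ge0 // => k _; exact: sqr_ge0.
Qed.

End Attainment.

(* Main.v *)
(** Every agent satisfies [cost y >= d y - b], where [d y] is its distance to
    [y]. At [med] this is an equality for the agents farther than [B], and for
    the others [cost med <= (d med - b) + 2 b]. Summing, the theorem follows
    from the fact that the median minimizes the total distance to the agents. *)

Require Import Defs.
From mathcomp Require Import all_boot all_order all_algebra.
From mathcomp Require Import all_classical all_reals all_analysis.
From mathcomp Require Import zify lra.

Set Implicit Arguments.
Unset Strict Implicit.
Unset Printing Implicit Defensive.

Import Order.TTheory GRing.Theory Num.Theory.
Local Open Scope ring_scope.

(** Common core of the three settings: each of them then only has to show that its median minimizes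
    the total distance. *)
Lemma SC_geometric_median_le (R : realType) (V : zmodType) (nm : V -> R)
    (n : nat) (B : R) (I : n.-tuple (V * R)) (med : V) :
  (forall v, 0 <= nm v) -> prefs_bounded B I -> is_geometric_median nm I med ->
  let A := agents_within nm B med I in
  SC nm med I <= OPT nm I + 2 * #|A|%:R * avg_pref I A.
Proof.
move=> nm_ge0 bI medP /=; set A := agents_within _ _ _ _.
have -> : 2 * #|A|%:R * avg_pref I A = 2 * \sum_(i in A) pref I i.
  rewrite -mulrA /avg_pref; congr (2 * _).
  have [->|A0] := eqVneq A finset.set0.
    by rewrite cards0 mul0r big_set0.
  by rewrite mulrC divfK // pnatr_eq0 cards_eq0.
(* [OPT] is an infimum, so it suffices to compare with an arbitrary [y]. *)
rewrite -lerBlDr; apply: lb_le_inf; first by exists (SC nm 0 I), 0.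
move=> _ [y _ <-]; rewrite lerBlDr.
apply: (@le_trans _ _ (\sum_(i < n) (nm (loc I i - med) - pref I i)
                       + 2 * \sum_(i in A) pref I i)).
  rewrite mulr_sumr [X in _ + X]big_mkcond /= -big_split /=.
  apply: ler_sum => i _; have /andP[b0 bB] := bI i.
  have d0 := nm_ge0 (loc I i - med).
  rewrite /cost -/(loc I i) -/(pref I i) /A /agents_within finset.inE.
  (* Near agents: [d - b] and [b - d] are both at most [d + b]. Far agents: [d > B >= b], so the
     cost is exactly [d - b]. *)
  have [_|Bd] := leP (nm (loc I i - med)) B.
    by rewrite ler_norml; lra.
  by rewrite ger0_norm; lra.
rewrite lerD2r.
apply: (@le_trans _ _ (\sum_(i < n) (nm (loc I i - y) - pref I i))).
  by rewrite !sumrB lerD2r.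
by apply: ler_sum => i _; exact: ler_norm.
Qed.

(** The total distance to two points is at least their gap, with equality at every point between
    them. *)
Lemma rank_median_min (R : realType) (n : nat) (x : 'I_n -> R) (z : R) :
  \sum_(i < n) `|x i - rank_median x| <= \sum_(i < n) `|x i - z|.
Proof.
case: n x => [|n] x; first by rewrite !big_ord0.
set m := rank_median x; set s := sort <=%R [seq x i | i <- enum 'I_n.+1].
have sz : size s = n.+1 by rewrite size_sort size_map size_enum_ord.
have sumE y : \sum_i `|x i - y| = \sum_(i < n.+1) `|s`_i - y|.
  transitivity (\sum_(t <- s) `|t - y|).
    rewrite /s (perm_big [seq x i | i <- enum 'I_n.+1]) /=.
      by rewrite big_map big_enum.
    exact/permPl/perm_sort.
  by rewrite (big_nth 0) sz big_mkord.
have smono (i j : nat) : (i <= j)%N -> (j <= n)%N -> s`_i <= s`_j.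
  move=> ij jn; apply: (sorted_leq_nth le_trans le_refl) => //.
  - exact: sort_le_sorted.
  - by rewrite inE sz ltnS (leq_trans ij).
  - by rewrite inE sz.
(* There are now [n.+1] elements, so the zero-based index is [(n.+2 %/ 2).-1]. *)
have mE : m = s`_(n %/ 2).
  by rewrite /m /rank_median -/s -addn2 divnDr // addn1.
(* Pair the ranks [i] and [n - i]: [m] lies between the two elements. *)
have pair_le (i : 'I_n.+1) :
    `|s`_i - m| + `|s`_(rev_ord i) - m| <= `|s`_i - z| + `|s`_(rev_ord i) - z|.
  have i_le : (i <= n)%N by rewrite -ltnS.
  rewrite /= subSS.
  have -> : `|s`_i - m| + `|s`_(n - i) - m| = `|s`_i - s`_(n - i)|.
    rewrite mE; have [ik|ki] := leqP i (n %/ 2).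
      have h1 := smono i (n %/ 2)%N ltac:(lia) ltac:(lia).
      have h2 := smono (n %/ 2)%N (n - i)%N ltac:(lia) ltac:(lia).
      rewrite ler0_norm ?subr_le0// ger0_norm ?subr_ge0// ler0_norm; lra.
    have h1 := smono (n %/ 2)%N i ltac:(lia) ltac:(lia).
    have h2 := smono (n - i)%N (n %/ 2)%N ltac:(lia) ltac:(lia).
    rewrite ger0_norm ?subr_ge0// ler0_norm ?subr_le0// ger0_norm; lra.
  by rewrite (distrC s`_(n - i) z); exact: ler_distD.
(* Letting [i] run over all ranks counts every element twice; a middle rank is paired with itself,
   so both parities are treated alike. *)
have dbl y : \sum_(i < n.+1) (`|s`_i - y| + `|s`_(rev_ord i) - y|)
    = 2 * \sum_(i < n.+1) `|s`_i - y|.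
  rewrite big_split /= mulr_natl mulr2n; congr (_ + _).
  by rewrite [RHS](reindex_inj rev_ord_inj).
rewrite !sumE -(ler_pM2l (ltr0Sn R 1)) -!dbl.
by apply: ler_sum => i _; exact: pair_le.
Qed.

Theorem theorem4 (R : realType) (n : nat) (n_gt0 : (0 < n)%N) (B : R) :
  [/\ (forall I : n.-tuple (R * R), prefs_bounded B I ->
        let med := rank_median (loc I) in
        let A := agents_within Num.norm B med I in
        SC Num.norm med I
          <= OPT Num.norm I + 2 * #|A|%:R * avg_pref I A),
      (forall I : n.-tuple ('rV[R]_2 * R), prefs_bounded B I ->
        let med := coord_median (loc I) in
        let A := agents_within (@l1norm R) B med I in
        SC (@l1norm R) med I
          <= OPT (@l1norm R) I + 2 * #|A|%:R * avg_pref I A)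
    & (forall (I : n.-tuple ('rV[R]_2 * R)) (med : 'rV[R]_2),
        prefs_bounded B I -> is_geometric_median (@l2norm R) I med ->
        let A := agents_within (@l2norm R) B med I in
        SC (@l2norm R) med I
          <= OPT (@l2norm R) I + 2 * #|A|%:R * avg_pref I A)].
Proof.
split=> [I bI|I bI|I med bI medP].
- apply: SC_geometric_median_le => // z; exact: rank_median_min.
- apply: SC_geometric_median_le => // [v|z]; first exact: sumr_ge0.
  (* The total L1 distance splits into one sum per coordinate, and [coord_median] minimizes each of
     them separately. *)
  rewrite /l1norm exchange_big [leRHS]exchange_big /=.
  apply: ler_sum => j _.
  under eq_bigr do rewrite !mxE.
  under [leRHS]eq_bigr do rewrite !mxE.
  exact: rank_median_min.
- by apply: SC_geometric_median_le => // v; exact: sqrtr_ge0.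
Qed.
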